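(* In the two-period model with a transparent bailout and $p_0<p_g<1-S$, in any delayed stimulation equilibrium we have $\hat\theta=\theta_0$, $\hat\theta_g\in[\theta_0,p_g+S)$ and $\theta_2=p_g+S$. Moreover: (i) types $\theta\le\theta_0$ sell in both periods, and a positive (possibly full) measure of them accept the bailout; (ii) among types $\theta\le\theta_0$, those that sell to the market at $t=1$ (if any) receive price $p_0$ at $t=1$ and price $p_g$ from the $t=2$ market, while those that accept the bailout sell at price $p_0$ at $t=2$; both groups have the same average asset value $\mathbb{E}[\theta\mid\theta\le\theta_0]=p_0$; (iii) types $\theta\in(\theta_0,\hat\theta_g]$ sell only at $t=1$, to the government at $p_g$; (iv) types $\theta\in(\hat\theta_g,p_g+S]$ sell only at $t=2$, at price $p_g$, and types $\theta>p_g+S$ never sell.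
   Context: Two-period model: a continuum of firms with privately known type $\theta\in[0,1]$, cdf $F$, density $f>0$, $f$ strictly log-concave, and for every $b\in(0,1]$ the map $a\mapsto 2\mathbb{E}[\theta\mid a<\theta<b]-\mathbb{E}[\theta\mid\theta\le a]$ is increasing on $(0,b)$. A type-$\theta$ firm holds one unit of an asset worth $\theta$ in each of two periods $t=1,2$. In each period it has a project with cost $I>0$ and net return $S>0$ that can be funded only by selling that period's unit; selling that unit at price $p\ge I$ yields $p+S$ for that period, not selling yields $\theta$. A firm's total payoff is the sum of the two periods' payoffs (period-2 payoff weighted by $\delta<1$, and equilibria are considered in the limit $\delta\to1$). In each period competitive short-lived risk-neutral buyers make price offers (Bertrand; break even in expectation; indifferent buyers buy). At $t=1$ only, the government offers to buy one unit at price $p_g$; each firm then sells its $t=1$ unit to the government, to the market, or not at all. Sales to the market at $t=1$ are not observed by $t=2$ buyers. Transparent bailout: acceptance of the government offer is observed by $t=2$ buyers, who may make different offers to bailout recipients and non-recipients. Equilibrium means perfect Bayesian equilibrium. Laissez-faire: $\theta_0\in(0,1)$ uniquely solves $\theta_0-S=\mathbb{E}[\theta\mid\theta\le\theta_0]$, $p_0:=\mathbb{E}[\theta\mid\theta\le\theta_0]$, and $p_0\ge I$. Equilibrium structure: every equilibrium has cutoffs $0<\hat\theta\le\hat\theta_g\le\theta_2$ such that types $\theta\le\hat\theta$ sell in both periods, types in $(\hat\theta,\hat\theta_g]$ sell only at $t=1$ to the government, types in $(\hat\theta_g,\theta_2]$ sell only at $t=2$, and types above $\theta_2$ never sell. A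 short-lived stimulation equilibrium is an equilibrium with $\hat\theta_g=\theta_2$; a delayed stimulation equilibrium is one with $\hat\theta_g<\theta_2$. *)

(* Defs.v *)
From HB Require Import structures.
From mathcomp Require Import all_boot all_order all_algebra.
From mathcomp Require Import all_classical all_reals all_analysis.
Import Order.TTheory GRing.Theory Num.Theory.
Set Implicit Arguments. Unset Strict Implicit. Unset Printing Implicit Defensive.
Local Open Scope classical_set_scope.
Local Open Scope ring_scope.

Definition mass {R : realType} (f : R -> R) (A : set R) : R :=
  fine (\int[@lebesgue_measure R]_(x in A `&` `[0%R, 1%R]) (f x)%:E)%E.

Definition cexp {R : realType} (f : R -> R) (A : set R) : R :=
  fine (\int[@lebesgue_measure R]_(x in A `&` `[0%R, 1%R]) (x * f x)%:E)%E
  / mass f A.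

Definition is_density {R : realType} (f : R -> R) : Prop :=
  measurable_fun setT f /\
  (forall x, 0 <= x <= 1 -> 0 < f x) /\
  (\int[@lebesgue_measure R]_(x in `[0%R, 1%R]) (f x)%:E = 1)%E.

Definition strictly_logconcave {R : realType} (f : R -> R) : Prop :=
  forall x y t, 0 <= x <= 1 -> 0 <= y <= 1 -> x != y -> 0 < t < 1 ->
    t * ln (f x) + (1 - t) * ln (f y) < ln (f (t * x + (1 - t) * y)).

Definition monotone_condition {R : realType} (f : R -> R) : Prop :=
  forall b, 0 < b <= 1 -> forall a a', 0 < a -> a < a' -> a' < b ->
    2 * cexp f [set x | a < x < b] - cexp f [set x | x <= a]
    < 2 * cexp f [set x | a' < x < b] - cexp f [set x | x <= a'].

(** * The two-period game with a transparent bailout (delta = 1 limit) *)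

Inductive act1 := Gov | Mkt | NoSale.

(* one-period payoff of selling the unit at price p (project funded iff p >= I) *)
Definition sellpay {R : realType} (I S p : R) : R :=
  if I <= p then p + S else p.

(* A strategy profile / price system:
   a1 theta  : t=1 action of type theta
   s2 theta  : whether type theta sells its t=2 unit (on path)
   p1        : t=1 market price
   p2g, p2n  : t=2 market prices offered to bailout recipients / non-recipients *)
Record profile (R : realType) := Profile {
  a1 : R -> act1 ;
  s2 : R -> bool ;
  p1 : R ;
  p2g : R ;
  p2n : R }.

Section Game.
Context {R : realType} (f : R -> R) (I S pg : R) (sg : profile R).

Definition pay1 (a : act1) (th : R) : R :=
  match a with
  | Gov => sellpay I S pg
  | Mkt => sellpay I S (p1 sg)
  | NoSale => th
  end.

Definition price2 (a : act1) : R :=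
  match a with Gov => p2g sg | _ => p2n sg end.

Definition cont2 (a : act1) (th : R) : R :=
  Num.max (sellpay I S (price2 a)) th.

Definition eqpay (th : R) : R :=
  pay1 (a1 sg th) th +
  (if s2 sg th then sellpay I S (price2 (a1 sg th)) else th).

Definition recipients : set R := [set th | a1 sg th = Gov].
Definition nonrecipients : set R := [set th | a1 sg th <> Gov].
Definition mkt_sellers1 : set R := [set th | a1 sg th = Mkt].

(* competitive Bertrand market for a pool P with sellers Sel and deviation
   acceptance sets Acc p' (types accepting an offer p' above the price p):
   buyers break even; no buyer can profitably offer a higher price *)
Definition market_ok (p : R) (Sel : set R) (Acc : R -> set R) : Prop :=
  (0 < mass f Sel -> p = cexp f Sel) /\
  (forall p', p < p' -> 0 < mass f (Acc p') -> cexp f (Acc p') <= p').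

Definition equilibrium : Prop :=
  (forall a, measurable [set th | a1 sg th = a]) /\
  measurable [set th | s2 sg th] /\
  (* prices lie in the range of asset values *)
  0 <= p1 sg <= 1 /\ 0 <= p2g sg <= 1 /\ 0 <= p2n sg <= 1 /\
  (forall th, 0 <= th <= 1 ->
     (s2 sg th -> th <= sellpay I S (price2 (a1 sg th))) /\
     (~~ s2 sg th -> sellpay I S (price2 (a1 sg th)) <= th)) /\
  (forall th a, 0 <= th <= 1 ->
     pay1 a th + cont2 a th <= pay1 (a1 sg th) th + cont2 (a1 sg th) th) /\
  (* t = 1 market (pool: all firms; t=1 market sales unobserved at t=2) *)
  market_ok (p1 sg) mkt_sellers1
    (fun p' => [set th | eqpay th <= sellpay I S p' + cont2 Mkt th]) /\
  market_ok (p2g sg) (recipients `&` [set th | s2 sg th])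
    (fun p' => recipients `&` [set th | th <= sellpay I S p']) /\
  market_ok (p2n sg) (nonrecipients `&` [set th | s2 sg th])
    (fun p' => nonrecipients `&` [set th | th <= sellpay I S p']).

Definition has_cutoffs (th1 thg th2 : R) : Prop :=
  0 < th1 /\ th1 <= thg /\ thg <= th2 /\ th2 <= 1 /\
  forall th, 0 <= th <= 1 ->
    (th <= th1 -> a1 sg th <> NoSale /\ s2 sg th) /\
    (th1 < th <= thg -> a1 sg th = Gov /\ ~~ s2 sg th) /\
    (thg < th <= th2 -> a1 sg th = NoSale /\ s2 sg th) /\
    (th2 < th -> a1 sg th = NoSale /\ ~~ s2 sg th).

End Game.

(* Main.v *)
(* A type selling in both periods earns the same amount whatever its type and
   whatever its period-1 buyer, and the type [th1] is indifferent between this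
   and waiting. So the prices [p1] and [p2g] faced by the early sellers
   agree once non-recipients obtain [p2n = pg], and breaking even on both groups
   gives [th1 - S = E[theta | theta <= th1]], i.e. [th1 = th0]. The remaining
   possibilities, [p2n > pg] or no early type accepting the bailout, are excluded
   by a profitable overbid of some buyer, by uniqueness of [th0], or, when all
   types sell at [t = 2], by strict log-concavity, which makes
   [t - E[theta | theta <= t]] strictly increasing. *)
Require Import Defs.
From HB Require Import structures.
From mathcomp Require Import all_boot all_order all_algebra.
From mathcomp Require Import all_classical all_reals all_analysis.
From mathcomp Require Import measurable_realfun ring lra.
Set Implicit Arguments. Unset Strict Implicit. Unset Printing Implicit Defensive.
Import Order.TTheory GRing.Theory Num.Theory.
Local Open Scope classical_set_scope.
Local Open Scope ring_scope.

(** * Lebesgue integrals *)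

(** A nonnegative function with zero integral vanishes almost everywhere, so [E] would be null. *)
Lemma Rintegral_gt0 d (T : measurableType d) (R : realType)
    (mu : {measure set T -> \bar R}) (D E : set T) (h : T -> R) :
  measurable D -> measurable E -> E `<=` D ->
  mu.-integrable D (EFin \o h) -> (forall x, D x -> 0 <= h x) ->
  mu E != 0%E -> (forall x, E x -> 0 < h x) ->
  0 < \int[mu]_(x in D) h x.
Proof.
move=> mD mE ED ih h0 muE hE; rewrite lt0r Rintegral_ge0// andbT.
apply: contra_neq muE => ih0.
have mh := measurable_int mu ih.
have : (\int[mu]_(x in D) `|(EFin \o h) x| = 0)%E.
  rewrite (_ : (\int[mu]_(x in D) _)%E = (\int[mu]_(x in D) (h x)%:E)%E).
    by rewrite -[LHS]fineK ?(integrable_fin_num mD)// [fine _]ih0.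
  by apply: eq_integral => x /set_mem Dx; rewrite gee0_abs// lee_fin h0.
move=> /(ae_eq_integral_abs _ mD mh)[N [mN N0 subN]].
apply: (subset_measure0 mE mN) => // x Ex; apply: subN => /= /(_ (ED _ Ex)) [].
by move=> h0x; have := hE _ Ex; rewrite h0x ltxx.
Qed.

(** The translated measure agrees with Lebesgue measure on half-open intervals, which determine
    it. *)
Lemma lebesgue_measureB {R : realType} (c : R) (A : set R) : measurable A ->
  pushforward lebesgue_measure
    ((fun x => x - c) : R -> measurableTypeR R) A = lebesgue_measure A.
Proof.
have mB : measurable_fun [set: R] ((fun x => x - c) : R -> measurableTypeR R).
  exact: measurable_funB.
move=> mA; apply/esym/lebesgue_measure_unique => //= _ [[a b]] _ <-.
rewrite /pushforward.
rewrite [X in _ = lebesgue_measure X](_ : _ = `]a + c, b + c]%classic); last first.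
  by apply/seteqP; split => x /=; rewrite !in_itv/= ltrBrDr lerBlDr.
rewrite !lebesgue_measure_itv/= !lte_fin ltrD2r; case: ifP => // _.
by rewrite -!EFinB; congr EFin; ring.
Qed.

Section shift.
Context {R : realType} (c a b : R) (h : R -> R).
Hypothesis mh : measurable_fun [set: R] h.
Hypothesis ih : lebesgue_measure.-integrable `[a, b] (EFin \o h).

Let mshift : measurable_fun [set: measurableTypeR R]
  ((fun x => x - c) : measurableTypeR R -> measurableTypeR R).
Proof. exact: measurable_funB. Qed.

Let preimage_shift : (fun x => x - c) @^-1` `[a, b]%classic = `[a + c, b + c]%classic.
Proof. by apply/seteqP; split => x /=; rewrite !in_itv/= lerBrDr lerBlDr. Qed.

Lemma ge0_Rintegral_shift : (forall x, x \in `[a, b] -> 0 <= h x) ->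
  \int[lebesgue_measure]_(x in `[a + c, b + c]) h (x - c) =
  \int[lebesgue_measure]_(x in `[a, b]) h x.
Proof.
move=> h0; rewrite /Rintegral; congr fine.
rewrite -preimage_shift.
rewrite -(@ge0_integral_pushforward _ _ _ _ _ _ mshift lebesgue_measure _ (EFin \o h))//=.
- by apply: eq_measure_integral => A mA _; exact: lebesgue_measureB.
- by apply/measurable_EFinP; exact: measurable_funTS.
- by move=> x /set_mem xab; rewrite lee_fin h0.
Qed.

Lemma integrable_shift :
  lebesgue_measure.-integrable `[a + c, b + c] (EFin \o (fun x => h (x - c))).
Proof.
apply/integrableP; split.
  apply/measurable_EFinP; apply: measurable_funTS.
  exact: (measurableT_comp mh mshift).
rewrite -preimage_shift.
rewrite -(@ge0_integral_pushforward _ _ _ _ _ _ mshift lebesgue_measure _ (fun x => `|(h x)%:E|)%E)//=.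
- rewrite (eq_measure_integral lebesgue_measure); last first.
    by move=> A mA _; exact: lebesgue_measureB.
  by case/integrableP : ih.
- by do 2 apply: measurableT_comp => //; exact: measurable_funTS.
Qed.

End shift.

(** * Conditional expectations of a density on [[0, 1]] *)

(** The numerator of [cexp], named because, unlike the quotient, it is additive over disjoint
    sets. *)
Definition moment {R : realType} (f : R -> R) (A : set R) : R :=
  fine (\int[@lebesgue_measure R]_(x in A `&` `[0%R, 1%R]) (x * f x)%:E)%E.

Section density.
Context {R : realType} (f : R -> R).
Hypothesis hf : is_density f.
Implicit Types (A B : set R) (a b c : R).

Let mf : measurable_fun setT f. Proof. by case: hf. Qed.

Let f_gt0 x : 0 <= x <= 1 -> 0 < f x. Proof. by case: hf => _ [fp _]; exact: fp. Qed.

Lemma eq_mass A B : A `&` `[0, 1] = B `&` `[0, 1] -> mass f A = mass f B.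
Proof. by rewrite /mass => ->. Qed.

Lemma eq_cexp A B : A `&` `[0, 1] = B `&` `[0, 1] -> cexp f A = cexp f B.
Proof. by rewrite /cexp /mass => ->. Qed.

Lemma measurable_clip A : measurable A -> measurable (A `&` `[0, 1]%classic : set (measurableTypeR R)).
Proof. by move=> mA; apply: measurableI. Qed.

Lemma integrable_density A : measurable A ->
  lebesgue_measure.-integrable (A `&` `[0, 1]) (EFin \o f).
Proof.
move=> mA.
have i01 : lebesgue_measure.-integrable `[0%R, 1%R]%classic (EFin \o f).
  apply/integrableP; split; first by apply/measurable_EFinP; exact: measurable_funTS.
  case: hf => _ [_ int1].
  rewrite (_ : (\int[_]_(x in _) _)%E = 1%E) ?ltry// -int1.
  apply: eq_integral => x /set_mem /=; rewrite in_itv/= => /f_gt0 fx.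
  by rewrite gtr0_norm.
by apply: integrableS i01 => //; exact: measurable_clip.
Qed.

Lemma integrable_moment A : measurable A ->
  lebesgue_measure.-integrable (A `&` `[0, 1]) (EFin \o (fun x => x * f x)).
Proof.
move=> mA; apply: (le_integrable _ _ _ (integrable_density mA)).
- exact: measurable_clip.
- by apply/measurable_EFinP; apply: measurable_funTS; exact: measurable_funM.
- move=> x [_ /=]; rewrite in_itv/= => x01; have fx := f_gt0 x01.
  by rewrite lee_fin normrM ler_piMl// ger0_norm; case/andP: x01.
Qed.

Lemma mass_ge0 A : 0 <= mass f A.
Proof.
by apply: Rintegral_ge0 => x [_ /=]; rewrite in_itv/= => /f_gt0/ltW.
Qed.

Lemma moment_ge0 A : 0 <= moment f A.
Proof.
apply: Rintegral_ge0 => x [_ /=]; rewrite in_itv/= => x01.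
by rewrite mulr_ge0//; [case/andP: x01 | exact/ltW/f_gt0].
Qed.

Lemma moment_le_mass A : measurable A -> moment f A <= mass f A.
Proof.
move=> mA; apply: le_Rintegral.
- exact: measurable_clip.
- exact: integrable_moment.
- exact: integrable_density.
- move=> x [_ /=]; rewrite in_itv/= => x01.
  by rewrite ler_piMl//; [exact/ltW/f_gt0 | case/andP: x01].
Qed.

Lemma massU A B : measurable A -> measurable B -> A `&` B = set0 ->
  mass f (A `|` B) = mass f A + mass f B.
Proof.
move=> mA mB AB; rewrite /mass setIUl; apply: Rintegral_setU.
- exact: measurable_clip.
- exact: measurable_clip.
- by rewrite -setIUl; apply: integrable_density; exact: measurableU.
- by apply/disj_set2P; rewrite setIACA AB set0I.
Qed.

Lemma momentU A B : measurable A -> measurable B -> A `&` B = set0 ->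
  moment f (A `|` B) = moment f A + moment f B.
Proof.
move=> mA mB AB; rewrite /moment setIUl -!/(Rintegral _ _ (fun x : R => x * f x)).
apply: Rintegral_setU.
- exact: measurable_clip.
- exact: measurable_clip.
- by rewrite -setIUl; apply: integrable_moment; exact: measurableU.
- by apply/disj_set2P; rewrite setIACA AB set0I.
Qed.

Lemma mass_gt0 A a b : measurable A -> 0 <= a -> a < b -> b <= 1 ->
  (forall x, a < x < b -> A x) -> 0 < mass f A.
Proof.
move=> mA a0 ab b1 abA.
have sub01 x : a < x < b -> 0 <= x <= 1.
  by move=> /andP[ax xb]; rewrite (le_trans a0 (ltW ax)) (le_trans (ltW xb) b1).
have ab0 : lebesgue_measure (`]a, b[%classic : set R) != 0%E.
  by rewrite lebesgue_measure_itv/= lte_fin ab -EFinB eqe subr_eq0 gt_eqF.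
apply: (Rintegral_gt0 (E := `]a, b[%classic : set (measurableTypeR R))) => //.
- exact: measurable_clip.
- move=> x /=; rewrite in_itv/= => xab; split; first exact: abA.
  by rewrite /= in_itv/= sub01.
- exact: integrable_density.
- by move=> x [_ /=]; rewrite in_itv/= => /f_gt0/ltW.
- by move=> x /=; rewrite in_itv/= => /sub01/f_gt0.
Qed.

Lemma moment_sub A c : measurable A -> c * mass f A - moment f A =
  \int[lebesgue_measure]_(x in A `&` `[0, 1]) ((c - x) * f x).
Proof.
move=> mA; have mA' := measurable_clip mA.
have i1 := integrable_density mA; have i2 := integrable_moment mA.
rewrite /mass -/(Rintegral _ _ f) -RintegralZl// /moment.
rewrite -/(Rintegral _ _ (fun x : R => x * f x)) -RintegralB//; last first.
  by apply: (eq_integrable mA' _ _ _ (integrableZl mA' c i1)) => // x _ /=; rewrite EFinM.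
by apply: eq_Rintegral => x _; rewrite mulrBl.
Qed.

Lemma integrable_moment_sub A c : measurable A ->
  lebesgue_measure.-integrable (A `&` `[0, 1]) (EFin \o (fun x => (c - x) * f x)).
Proof.
move=> mA; have mA' := measurable_clip mA.
have i1 := integrable_density mA; have i2 := integrable_moment mA.
apply: (eq_integrable mA' _ _ _ (integrableB mA' (integrableZl mA' c i1) i2)) => //.
by move=> x _ /=; rewrite -EFinM -EFinB mulrBl.
Qed.

(** The integrands [(c - x) * f x] below vanish at [x = c]; positive measure away from this point is
    what makes the inequalities strict. *)
Let measure_mass_gt0 A c : measurable A -> 0 < mass f A ->
  lebesgue_measure ((A `&` `[0, 1]) `\ c) != 0%E.
Proof.
move=> mA; have mA' := measurable_clip mA; apply: contraTneq => A0.
rewrite -leNgt /mass (_ : (\int[_]_(x in _) _)%E = 0%E)//.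
apply: null_set_integral => //; first exact: (measurable_int _ (integrable_density mA)).
have mAc : measurable ((A `&` `[0, 1]) `\ c : set (measurableTypeR R)).
  exact: measurableD.
have U0 : lebesgue_measure ((A `&` `[0, 1]) `\ c `|` [set c]) = 0%E.
  by rewrite measureU0 ?(eqP A0)//; exact: lebesgue_measure_set1.
apply: (subset_measure0 _ _ _ U0) => //; first exact: measurableU.
by move=> x Ax; have [->|/eqP xc] := eqVneq x c; [right | left; split].
Qed.

Lemma moment_lt A c : measurable A ->
  (forall x, A x -> 0 <= x <= 1 -> x <= c) -> 0 < mass f A ->
  moment f A < c * mass f A.
Proof.
move=> mA Ac A0; have mA' := measurable_clip mA.
rewrite -subr_gt0 moment_sub//.
apply: (Rintegral_gt0 (E := (A `&` `[0, 1]) `\ c : set (measurableTypeR R))) => //.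
- exact: measurableD.
- exact: integrable_moment_sub.
- move=> x [Ax /=]; rewrite in_itv/= => x01.
  by rewrite mulr_ge0 ?subr_ge0 ?Ac// ltW// f_gt0.
- exact: measure_mass_gt0.
- move=> x [[Ax /=]]; rewrite in_itv/= => x01 /eqP xc.
  by rewrite mulr_gt0 ?f_gt0// subr_gt0 lt_neqAle xc Ac.
Qed.

Lemma moment_gt A c : measurable A ->
  (forall x, A x -> 0 <= x <= 1 -> c <= x) -> 0 < mass f A ->
  c * mass f A < moment f A.
Proof.
move=> mA Ac A0; have mA' := measurable_clip mA.
rewrite -subr_gt0 -opprB moment_sub// -mulN1r -RintegralZl//; last first.
  exact: integrable_moment_sub.
apply: (Rintegral_gt0 (E := (A `&` `[0, 1]) `\ c : set (measurableTypeR R))) => //.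
- exact: measurableD.
- by apply: (eq_integrable mA' _ _ _ (integrableZl mA' (-1) (integrable_moment_sub c mA))).
- move=> x [Ax /=]; rewrite in_itv/= => x01.
  by rewrite mulrA mulN1r opprB mulr_ge0 ?subr_ge0 ?Ac// ltW// f_gt0.
- exact: measure_mass_gt0.
- move=> x [[Ax /=]]; rewrite in_itv/= => x01 /eqP xc.
  by rewrite mulrA mulN1r opprB mulr_gt0 ?f_gt0// subr_gt0 lt_neqAle eq_sym xc Ac.
Qed.

Lemma cexp_lt A c : measurable A ->
  (forall x, A x -> 0 <= x <= 1 -> x <= c) -> 0 < mass f A -> cexp f A < c.
Proof. by move=> mA Ac A0; rewrite /cexp ltr_pdivrMr//; exact: moment_lt. Qed.

Lemma cexp_gt A c : measurable A ->
  (forall x, A x -> 0 <= x <= 1 -> c <= x) -> 0 < mass f A -> c < cexp f A.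
Proof. by move=> mA Ac A0; rewrite /cexp ltr_pdivlMr//; exact: moment_gt. Qed.

Lemma moment_cexp A : 0 < mass f A -> moment f A = cexp f A * mass f A.
Proof. by move=> A0; rewrite /cexp -/(moment f A) divfK// gt_eqF. Qed.

Lemma moment_null A : measurable A -> mass f A = 0 -> moment f A = 0.
Proof.
move=> mA A0; apply/eqP; rewrite eq_le moment_ge0 andbT -A0.
exact: moment_le_mass.
Qed.

Lemma cexpUl A B : measurable A -> measurable B -> A `&` B = set0 ->
  mass f A = 0 -> cexp f (A `|` B) = cexp f B.
Proof.
move=> mA mB AB A0; rewrite /cexp -/(moment f _) -/(moment f B).
by rewrite massU// momentU// A0 moment_null// !add0r.
Qed.

(** The condition on [B] is guarded by positive mass: on a null set [cexp] divides by zero and takes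
    the value 0. *)
Lemma cexpU A B e : measurable A -> measurable B -> A `&` B = set0 ->
  0 < mass f A -> cexp f A = e -> (0 < mass f B -> cexp f B = e) ->
  cexp f (A `|` B) = e.
Proof.
move=> mA mB AB A0 eA eB; have [B0|B0] := ltP 0 (mass f B); last first.
  rewrite setUC cexpUl//; first by rewrite setIC.
  by apply/eqP; rewrite eq_le B0 mass_ge0.
rewrite /cexp -/(moment f _) momentU// massU// !moment_cexp// eA eB//.
by rewrite -mulrDr mulfK// gt_eqF// addr_gt0.
Qed.

Lemma cexp_gtU A B e : measurable A -> measurable B -> A `&` B = set0 ->
  0 < mass f A -> e < cexp f A -> (0 < mass f B -> e <= cexp f B) ->
  e < cexp f (A `|` B).
Proof.
move=> mA mB AB A0 eA eB; have [B0|B0] := ltP 0 (mass f B); last first.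
  rewrite setUC cexpUl//; first by rewrite setIC.
  by apply/eqP; rewrite eq_le B0 mass_ge0.
rewrite [in ltRHS]/cexp -/(moment f _) momentU// massU// !moment_cexp//.
rewrite ltr_pdivlMr ?addr_gt0// mulrDr ltr_leD// ?ltr_pM2r ?ler_pM2r//.
exact: eB.
Qed.

Lemma measurable_le c : measurable [set x : R | x <= c].
Proof. by rewrite -set_itvNyc; exact: measurable_itv. Qed.

Lemma mass_le_gt0 c : 0 < c -> 0 < mass f [set x | x <= c].
Proof.
move=> c0; have [c1|c1] := leP c 1.
  by apply: (@mass_gt0 _ 0 c) => //; [exact: measurable_le | move=> x /andP[_ /ltW]].
apply: (@mass_gt0 _ 0 1) => //; first exact: measurable_le.
by move=> x /andP[_ x1]; apply: ltW; exact: lt_trans c1.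
Qed.

(** The mean below [s] is less than [s], while the added types in [(s, t]] have mean above [s]. *)
Lemma cexp_le_incr s t : 0 < s -> s < t -> t <= 1 ->
  cexp f [set x | x <= s] < cexp f [set x | x <= t].
Proof.
move=> s0 st t1; have ms : measurable [set x : R | s < x <= t].
  by rewrite -set_itvoc; exact: measurable_itv.
have st0 : 0 < mass f [set x | s < x <= t].
  by apply: (@mass_gt0 _ s t) => //; [exact: ltW | move=> x /andP[sx xt]; rewrite /= sx ltW].
have -> : [set x | x <= t] = [set x | s < x <= t] `|` [set x | x <= s].
  apply/seteqP; split => x /=; first by case: (leP x s) => [|_ ->]; [right | left].
  by case => [/andP[]//|xs]; exact: le_trans xs (ltW st).
apply: cexp_gtU => //.
- exact: measurable_le.
- by apply/seteqP; split => // x [/= /andP[sx _]]; rewrite leNgt sx.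
- apply: (@lt_trans _ _ s); first by apply: cexp_lt => //; [exact: measurable_le | exact: mass_le_gt0].
  by apply: cexp_gt => // x /andP[/ltW].
Qed.

End density.

(** * Strictly log-concave densities *)

Section combination.
Context d (T : measurableType d) (R : realType) (mu : {measure set T -> \bar R}).
Variables (D : set T) (a b : R) (u v : T -> R).
Hypotheses (mD : measurable D) (iu : mu.-integrable D (EFin \o u))
  (iv : mu.-integrable D (EFin \o v)).

Lemma integrable_combination : mu.-integrable D (EFin \o (fun x => a * u x + b * v x)).
Proof.
apply: (eq_integrable mD _ _ _
  (integrableD mD (integrableZl mD a iu) (integrableZl mD b iv))) => x _.
by rewrite /= EFinD !EFinM.
Qed.

Lemma Rintegral_combination : \int[mu]_(x in D) (a * u x + b * v x) =
  a * (\int[mu]_(x in D) u x) + b * (\int[mu]_(x in D) v x).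
Proof.
rewrite RintegralD ?RintegralZl//.
- by apply: (eq_integrable mD _ _ _ (integrableZl mD a iu)) => x _; rewrite /= EFinM.
- by apply: (eq_integrable mD _ _ _ (integrableZl mD b iv)) => x _; rewrite /= EFinM.
Qed.

End combination.

Section logconcave.
Context {R : realType} (f : R -> R).
Hypotheses (hf : is_density f) (hlc : strictly_logconcave f).

Let mf : measurable_fun setT f. Proof. by case: hf. Qed.

Let f_gt0 x : 0 <= x <= 1 -> 0 < f x. Proof. by case: hf => _ [fp _]; exact: fp. Qed.

(** The ratio [f (x - c) / f x] increases in [x]. Both [a + c] and [b] are convex combinations of
    [a] and [b + c], with complementary weights, so the two log-concavity inequalities add up to the
    claim. *)
Lemma logconcave_mulr_lt a b c : 0 <= a -> a < b -> 0 < c -> b + c <= 1 ->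
  f a * f (b + c) < f (a + c) * f b.
Proof.
move=> a0 ab c0 bc1.
have fa : 0 < f a by apply: f_gt0; lra.
have fb : 0 < f b by apply: f_gt0; lra.
have fac : 0 < f (a + c) by apply: f_gt0; lra.
have fbc : 0 < f (b + c) by apply: f_gt0; lra.
have D0 : 0 < b + c - a by lra.
have Dn0 : b + c - a != 0 by rewrite gt_eqF.
have conv t : 0 < t < 1 -> t * ln (f a) + (1 - t) * ln (f (b + c)) <
    ln (f (t * a + (1 - t) * (b + c))).
  by move=> t01; apply: hlc => //; [lra | lra | rewrite lt_eqF//; lra].
have t1 : 0 < (b - a) / (b + c - a) < 1.
  by apply/andP; split; [apply: divr_gt0 => //; lra | rewrite ltr_pdivrMr// mul1r; lra].
have t2 : 0 < c / (b + c - a) < 1.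
  by apply/andP; split; [exact: divr_gt0 | rewrite ltr_pdivrMr// mul1r; lra].
have := ltrD (conv _ t1) (conv _ t2).
rewrite (_ : _ * a + _ = a + c); last by field.
rewrite (_ : _ * a + _ = b); last by field.
rewrite (_ : _ + _ + _ = ln (f a) + ln (f (b + c))); last by field.
by rewrite -!lnM ?posrE// ltr_ln// posrE mulr_gt0.
Qed.

(** By the increasing ratio, [Ft * f (x - c) <= Fs * f x] passes from a point to all points on its
    left, so the sign changes only at the supremum [z] of the points where it holds. *)
Lemma single_crossing s c Fs Ft : 0 < s -> 0 < c -> s + c <= 1 -> 0 < Fs -> 0 < Ft ->
  exists2 z, c <= z & forall x, c <= x <= s + c ->
    0 <= (x - z) * (Ft * f (x - c) - Fs * f x).
Proof.
move=> s0 c0 sc1 Fs0 Ft0.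
(* The point [c] is put into [Q] by hand, so that [Q] is nonempty and its supremum is at least
   [c]. *)
pose Q := [set x | x = c \/ c <= x <= s + c /\ Ft * f (x - c) <= Fs * f x].
have Qsup : has_sup Q.
  split; first by exists c; left.
  by exists (s + c) => x [->|[/andP[]]]//; lra.
have Qc : Q c by left.
exists (sup Q); first by apply: ub_le_sup => //; case: Qsup.
move=> x xc; have [xz|zx|->] := ltgtP x (sup Q); last by rewrite subrr mul0r.
- apply: mulr_le0; first by rewrite subr_le0 ltW.
  rewrite subr_le0.
  have [y Qy xy] := sup_gt (ex_intro _ _ Qc) xz.
  case: Qy => [yc|[yc Qy]]; first by lra.
  have /ltW lx : f (x - c) * f y < f x * f (y - c).
    have := @logconcave_mulr_lt (x - c) (y - c) c.
    by rewrite !subrK; apply; lra.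
  have fyc : 0 < f (y - c) by apply: f_gt0; lra.
  have fy : 0 < f y by apply: f_gt0; lra.
  have fx : 0 < f x by apply: f_gt0; lra.
  rewrite -(ler_pM2r fy) -mulrA.
  apply: (le_trans (ler_wpM2l (ltW Ft0) lx)).
  by rewrite mulrCA [leRHS]mulrAC mulrC ler_pM2r.
- apply: mulr_ge0; first by rewrite subr_ge0 ltW.
  rewrite subr_ge0 leNgt; apply/negP => /ltW Qx.
  by have := ub_le_sup (proj2 Qsup) (or_intror (conj xc Qx) : Q x); rewrite leNgt zx.
Qed.

(* The density [f] shifted by [t - s] and restricted to [[t - s, t]] dominates
   [f] restricted to [[0, t]] in the likelihood ratio order: their normalised
   difference changes sign only once, at [z], so its integral against
   [x - z] is positive. *)
Lemma sub_cexp_le_incr s t : 0 < s -> s < t -> t <= 1 ->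
  s - cexp f [set x | x <= s] < t - cexp f [set x | x <= t].
Proof.
move=> s0 st t1; have [c c0 tE] : exists2 c, 0 < c & t = s + c.
  by exists (t - s); [rewrite subr_gt0 | rewrite addrCA subrr addr0].
rewrite {}tE in st t1 *.
set Fs := mass f [set x | x <= s]; set Ft := mass f [set x | x <= s + c].
have Fs0 : 0 < Fs by exact: mass_le_gt0.
have Ft0 : 0 < Ft by apply: mass_le_gt0 => //; lra.
have [z cz zP] := single_crossing s0 c0 t1 Fs0 Ft0.
pose D := `[0 + c, s + c]%classic : set (measurableTypeR R).
have mD : measurable D by exact: measurable_itv.
have sE : [set x | x <= s] `&` `[0, 1] = `[0, s]%classic.
  by apply/seteqP; split => x /=; rewrite !in_itv/=; lra.
have DE : D `&` `[0, 1] = D.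
  by apply/seteqP; split => x; rewrite /D /= !in_itv/=; lra.
have i1 : lebesgue_measure.-integrable D (EFin \o (fun x : R => f (x - c))).
  by apply: integrable_shift => //; rewrite -sE; apply: integrable_density => //; exact: measurable_le.
have mxf : measurable_fun [set: R] (fun x => x * f x) by exact: measurable_funM.
have i2 : lebesgue_measure.-integrable D (EFin \o (fun x : R => (x - c) * f (x - c))).
  apply: (@integrable_shift _ c 0 s (fun x => x * f x)) => //.
  by rewrite -sE; apply: integrable_moment => //; exact: measurable_le.
have I1 : \int[lebesgue_measure]_(x in D) f (x - c) = Fs.
  rewrite ge0_Rintegral_shift//; last by move=> x; rewrite in_itv/= => xs; apply/ltW/f_gt0; lra.
  by rewrite /Fs /mass sE.
have I2 : \int[lebesgue_measure]_(x in D) ((x - c) * f (x - c)) = moment f [set x | x <= s].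
  rewrite (@ge0_Rintegral_shift _ c 0 s (fun x => x * f x))//.
    by rewrite /moment sE.
  by move=> x; rewrite in_itv/= => xs; rewrite mulr_ge0//; [lra | apply/ltW/f_gt0; lra].
have j1 := integrable_density hf mD; have j2 := integrable_moment hf mD.
rewrite DE in j1 j2.
have cE : [set x | x <= s + c] = [set x | x < c] `|` D.
  by apply/seteqP; split => x; rewrite /D /= in_itv/=; lra.
have mc : measurable [set x : R | x < c] by rewrite -set_itvNyo; exact: measurable_itv.
have cD : [set x | x < c] `&` D = set0.
  by apply/seteqP; split => // x; rewrite /D /= in_itv/=; lra.
have Mt : moment f [set x | x <= s + c] = moment f [set x | x < c] + moment f D.
  by rewrite cE momentU.
have FtE : Ft = mass f [set x | x < c] + mass f D by rewrite /Ft cE massU.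
have Fc0 : 0 < mass f [set x | x < c].
  by apply: (@mass_gt0 _ _ hf _ 0 c) => //; [lra | move=> x /andP[]].
have Mc : moment f [set x | x < c] < c * mass f [set x | x < c].
  by apply: moment_lt => // x /= /ltW.
have MD : moment f D = \int[lebesgue_measure]_(x in D) (x * f x) by rewrite /moment DE.
have FD : mass f D = \int[lebesgue_measure]_(x in D) f x by rewrite /mass DE.
(* The single-crossing inequality integrated over [D], with [x - z] split as [(x - c) + (c - z)] in
   the shifted term. *)
have key : Fs * moment f D + (- (Fs * z)) * mass f D <=
    Ft * moment f [set x | x <= s] + Ft * (c - z) * Fs.
  rewrite MD FD -I2 -{3}I1 -!Rintegral_combination//.
  apply: le_Rintegral => //; [exact: integrable_combination|exact: integrable_combination|].
  move=> x; rewrite /D /= in_itv/= add0r => /zP; lra.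
(* The types below [c] are added to [key]: their mean is less than [c], hence less than [z].
   Division by [Fs * Ft] then gives the claim. *)
have : Fs * (moment f [set x | x <= s + c]) < Ft * moment f [set x | x <= s] + c * Fs * Ft.
  have h1 : Fs * (moment f [set x | x < c] - z * mass f [set x | x < c]) < 0.
    by rewrite pmulr_rlt0// subr_lt0 (lt_le_trans Mc)// ler_pM2r.
  by rewrite Mt; move: key h1; rewrite FtE; lra.
rewrite /cexp -!/(moment f _) -/Fs -/Ft => h.
have -> : s + c - moment f [set x | x <= s + c] / Ft = s - moment f [set x | x <= s] / Fs
   + (Ft * moment f [set x | x <= s] + c * Fs * Ft - Fs * moment f [set x | x <= s + c]) / (Fs * Ft).
  by field; rewrite !gt_eqF.
by rewrite ltrDl divr_gt0 ?subr_gt0 ?mulr_gt0.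
Qed.

End logconcave.

(** * Delayed stimulation equilibria *)

(** Transfers a constraint on the types just above a cutoff to the cutoff itself, whose own action
    may differ from theirs. *)
Lemma le_of_right {R : realFieldType} (a b x : R) : a < b ->
  (forall y, a < y <= b -> x <= y) -> x <= a.
Proof.
move=> ab h; rewrite leNgt; apply/negP => ax.
have [xb|bx] := leP x b.
  by have := h ((a + x) / 2); lra.
by have := h b; lra.
Qed.

Lemma sellpay_funded {R : realType} (I S p : R) : I <= p -> sellpay I S p = p + S.
Proof. by rewrite /sellpay => ->. Qed.

Lemma sellpay_gt {R : realType} (I S p : R) : p < sellpay I S p -> I <= p.
Proof. by rewrite /sellpay; case: (leP I p) => // _; rewrite ltxx. Qed.

Section delayed.
Context {R : realType} (f : R -> R) (I S pg th0 : R) (sg : profile R) (th1 thg th2 : R).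
Hypotheses (hf : is_density f) (hlc : strictly_logconcave f) (hI : 0 < I) (hS : 0 < S)
  (hth0 : 0 < th0 < 1)
  (hth0fix : th0 - S = cexp f [set x | x <= th0])
  (hth0uniq : forall t, 0 < t < 1 -> t - S = cexp f [set x | x <= t] -> t = th0)
  (hp0I : I <= cexp f [set x | x <= th0])
  (hpg : cexp f [set x | x <= th0] < pg < 1 - S)
  (heq : equilibrium f I S pg sg)
  (hcut : has_cutoffs sg th1 thg th2)
  (hdelayed : thg < th2).

Local Notation sell := (sellpay I S).
Local Notation below c := [set x : R | x <= c].
Local Notation gov := (below th1 `&` [set x | a1 sg x = Gov]).
Local Notation mkt := (below th1 `&` [set x | a1 sg x = Mkt]).
Local Notation late := [set x : R | thg < x <= th2].

Let th1_gt0 : 0 < th1. Proof. by case: hcut. Qed.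
Let th1_le : th1 <= thg. Proof. by case: hcut => _ []. Qed.
Let th2_le1 : th2 <= 1. Proof. by case: hcut => _ [_ [_ []]]. Qed.

Let p0E : cexp f (below th0) = th0 - S. Proof. by rewrite hth0fix. Qed.

(* [lra] does not see section hypotheses. *)
Ltac slra := generalize hI hS hth0 hp0I hpg hdelayed th1_gt0 th1_le th2_le1 p0E; lra.

Let sell_pg : sell pg = pg + S.
Proof. by apply: sellpay_funded; slra. Qed.

Let early th : 0 <= th <= th1 -> (a1 sg th = Gov \/ a1 sg th = Mkt) /\ s2 sg th.
Proof.
move=> th01; case: hcut => _ [_ [_ [_ h]]].
case: (h th) => [|+ _]; first by slra.
by case=> [|+ ->]; [slra | case: (a1 sg th) => // _; split=> //; [left | right]].
Qed.

Let middle th : th1 < th <= thg -> a1 sg th = Gov /\ ~~ s2 sg th.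
Proof.
move=> th01; case: hcut => _ [_ [_ [_ h]]].
by case: (h th) => [|_ [h' _]]; [slra | exact: h'].
Qed.

Let delayed th : thg < th <= th2 -> a1 sg th = NoSale /\ s2 sg th.
Proof.
move=> th01; case: hcut => _ [_ [_ [_ h]]].
by case: (h th) => [|_ [_ [h' _]]]; [slra | exact: h'].
Qed.

Let never th : th2 < th <= 1 -> a1 sg th = NoSale /\ ~~ s2 sg th.
Proof.
move=> th01; case: hcut => _ [_ [_ [_ h]]].
by case: (h th) => [|_ [_ [_ h']]]; [slra | apply: h'; slra].
Qed.

(** * Equilibrium conditions and incentive constraints *)

Let measurable_act a : measurable [set th | a1 sg th = a].
Proof. by case: heq => h _; exact: h. Qed.

Let s2_le th : 0 <= th <= 1 -> s2 sg th -> th <= sell (price2 sg (a1 sg th)).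
Proof. by case: heq => _ [_ [_ [_ [_ [h _]]]]] /h[]. Qed.

Let s2N_ge th : 0 <= th <= 1 -> ~~ s2 sg th -> sell (price2 sg (a1 sg th)) <= th.
Proof. by case: heq => _ [_ [_ [_ [_ [h _]]]]] /h[]. Qed.

(** Optimality of [s2] turns the on-path second-period payoff into the maximum in [cont2], so the
    no-deviation condition bounds [eqpay] itself. *)
Let eqpay_ge a th : 0 <= th <= 1 ->
  pay1 I S pg sg a th + Num.max (sell (price2 sg a)) th <= eqpay I S pg sg th.
Proof.
move=> th01; rewrite /eqpay.
have -> : (if s2 sg th then sell (price2 sg (a1 sg th)) else th) =
    cont2 I S sg (a1 sg th) th.
  case: ifPn => [/(s2_le th01)|/(s2N_ge th01)] h; rewrite /cont2.
    by rewrite max_l.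
  by rewrite max_r.
by case: heq => _ [_ [_ [_ [_ [_ [h _]]]]]]; exact: h.
Qed.

Let eqpay_ge_gov th : 0 <= th <= 1 ->
  pg + S + sell (p2g sg) <= eqpay I S pg sg th /\ pg + S + th <= eqpay I S pg sg th.
Proof.
move=> th01; have := eqpay_ge Gov th01; rewrite /= sell_pg => h.
by split; apply: le_trans h; rewrite lerD2l le_max lexx ?orbT.
Qed.

Let eqpay_ge_mkt th : 0 <= th <= 1 ->
  sell (p1 sg) + sell (p2n sg) <= eqpay I S pg sg th.
Proof.
move=> th01; have := eqpay_ge Mkt th01; apply: le_trans.
by rewrite /= lerD2l le_max lexx.
Qed.

Let eqpay_ge_nosale th : 0 <= th <= 1 ->
  th + sell (p2n sg) <= eqpay I S pg sg th.
Proof.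
move=> th01; have := eqpay_ge NoSale th01; apply: le_trans.
by rewrite /= lerD2l le_max lexx.
Qed.

Let late_in01 th : thg < th <= th2 -> 0 <= th <= 1. Proof. slra. Qed.

Let eqpay_late th : thg < th <= th2 -> eqpay I S pg sg th = th + sell (p2n sg).
Proof. by move=> /delayed[aE sE]; rewrite /eqpay aE sE. Qed.

Lemma th2_le_sell : th2 <= sell (p2n sg).
Proof.
have h : thg < th2 <= th2 by slra.
by have [aE sE] := delayed h; have := s2_le (late_in01 h) sE; rewrite aE.
Qed.

(** Type [th2], which sells only at t = 2, could take the bailout and keep its second unit. *)
Lemma sell_pg_le : pg + S <= sell (p2n sg).
Proof.
have h : thg < th2 <= th2 by slra.
by have [_] := eqpay_ge_gov (late_in01 h); rewrite eqpay_late//; slra.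
Qed.

Lemma p2n_funded : I <= p2n sg.
Proof.
have := sell_pg_le; rewrite /sellpay; case: (leP I) => // h1 h2; slra.
Qed.

Lemma sell_p2n : sell (p2n sg) = p2n sg + S.
Proof. exact/sellpay_funded/p2n_funded. Qed.

Let late_gov : pg + S + sell (p2g sg) <= thg + sell (p2n sg).
Proof.
rewrite -lerBlDr; apply: le_of_right hdelayed _ => y hy.
by have [] := eqpay_ge_gov (late_in01 hy); rewrite eqpay_late//; slra.
Qed.

Let late_mkt : sell (p1 sg) <= thg.
Proof.
apply: le_of_right hdelayed _ => y hy.
by have := eqpay_ge_mkt (late_in01 hy); rewrite eqpay_late//; slra.
Qed.

(** Types in [(th1, thg]] could instead wait and sell at t = 2, sell the second unit at [p2g], or
    sell to the market in both periods; each option gives one bound. *)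
Lemma gov_only_prices : th1 < thg ->
  [/\ sell (p2n sg) = pg + S, sell (p2g sg) <= th1 & sell (p1 sg) <= th1].
Proof.
move=> h1; have in01 th : th1 < th <= thg -> 0 <= th <= 1 by slra.
have payE th : th1 < th <= thg -> eqpay I S pg sg th = pg + S + th.
  by move=> /middle[aE sE]; rewrite /eqpay aE (negbTE sE) /= sell_pg.
have nE : sell (p2n sg) = pg + S.
  apply/eqP; rewrite eq_le sell_pg_le andbT.
  have hg : th1 < thg <= thg by slra.
  by have := eqpay_ge_nosale (in01 _ hg); rewrite payE//; slra.
split => //.
- apply: le_of_right h1 _ => y hy; have [aE sE] := middle hy.
  by have := s2N_ge (in01 _ hy) sE; rewrite aE.
- apply: le_of_right h1 _ => y hy.
  by have := eqpay_ge_mkt (in01 _ hy); rewrite payE// nE; slra.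
Qed.

(** The types just above [th1] either take only the bailout or, if [th1 = thg], wait; in both cases
    they decline to sell to the market. *)
Lemma sell_p1_le : sell (p1 sg) <= th1.
Proof.
have [h|h] := ltP th1 thg; first by case: (gov_only_prices h).
exact: le_trans late_mkt h.
Qed.

Let gov_le : pg + S + sell (p2g sg) <= th1 + sell (p2n sg).
Proof.
have [h|h] := ltP th1 thg; first by case: (gov_only_prices h); slra.
by have := late_gov; slra.
Qed.

Let eqpay_gov th : 0 <= th <= th1 -> a1 sg th = Gov ->
  eqpay I S pg sg th = pg + S + sell (p2g sg).
Proof. by move=> /early[_ sE] aE; rewrite /eqpay aE sE /= sell_pg. Qed.

Let eqpay_mkt th : 0 <= th <= th1 -> a1 sg th = Mkt ->
  eqpay I S pg sg th = sell (p1 sg) + sell (p2n sg).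
Proof. by move=> /early[_ sE] aE; rewrite /eqpay aE sE. Qed.

(* The payoff of a type selling in both periods does not depend on the type, and
   type [th1] weakly prefers it to [th1 + sell (p2n sg)]. *)
Lemma eqpay_early th : 0 <= th <= th1 -> eqpay I S pg sg th = th1 + sell (p2n sg).
Proof.
move=> h; have h1 : 0 <= th1 <= th1 by slra.
have in01 : 0 <= th1 <= 1 by slra.
have in01' : 0 <= th <= 1 by slra.
have [P1 G] := (sell_p1_le, gov_le).
have := eqpay_ge_nosale in01.
have [Gth _] := eqpay_ge_gov in01'; have Mth := eqpay_ge_mkt in01'.
(* [P1] and [G] bound both early payoffs by [th1 + sell (p2n sg)]. Since [th1] may wait, its own
   action attains this bound, and every early type can imitate that action. *)
have [[a'|a'] _] := early h1; rewrite ?(eqpay_gov h1 a') ?(eqpay_mkt h1 a') => V.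
  by have [[a|a] _] := early h; move: Gth Mth; rewrite ?(eqpay_gov h a) ?(eqpay_mkt h a); slra.
by have [[a|a] _] := early h; move: Gth Mth; rewrite ?(eqpay_gov h a) ?(eqpay_mkt h a); slra.
Qed.

(** * Pools of sellers and break-even prices *)

Let measurable_gov : measurable gov.
Proof. by apply: measurableI => //; exact: measurable_le. Qed.

Let measurable_mkt : measurable mkt.
Proof. by apply: measurableI => //; exact: measurable_le. Qed.

Let measurable_late : measurable late.
Proof. by rewrite -set_itvoc; exact: measurable_itv. Qed.

Let gov_mkt0 : gov `&` mkt = set0.
Proof. by apply/seteqP; split => // x [[_ /= ->] [_ /=]]. Qed.

(** Intersecting with the unit interval is essential: the cutoffs prescribe actions only there. *)
Let belowE : below th1 `&` `[0, 1] = (gov `|` mkt) `&` `[0, 1].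
Proof.
apply/seteqP; split => x /=; rewrite !in_itv/=; last by case=> [[[]|[]]].
move=> [xt x01]; split => //; have [|[a|a] _] := @early x; first by slra.
  by left.
by right.
Qed.

Let mass_below : mass f (below th1) = mass f gov + mass f mkt.
Proof. by rewrite (eq_mass f belowE) massU. Qed.

Lemma pool_p1 : 0 < mass f mkt -> p1 sg = cexp f mkt.
Proof.
move=> M0; case: heq => _ [_ [_ [_ [_ [_ [_ [[h _] _]]]]]]].
have E : mkt_sellers1 sg `&` `[0, 1] = mkt `&` `[0, 1].
  apply/seteqP; split => x /=; rewrite !in_itv/=; last by case=> [[]].
  move=> [aE x01]; split => //; split => //=; rewrite leNgt; apply/negP => xt.
  move: aE; rewrite /mkt_sellers1/=.
  have [xg|gx] := leP x thg; first by have [|->] := @middle x; first slra.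
  have [x2|x2] := leP x th2; first by have [|->] := @delayed x; first slra.
  by have [|->] := @never x; first slra.
by rewrite -(eq_cexp f E) h// (eq_mass f E).
Qed.

Lemma pool_p2g : 0 < mass f gov -> p2g sg = cexp f gov.
Proof.
move=> G0; case: heq => _ [_ [_ [_ [_ [_ [_ [_ [[h _] _]]]]]]]].
have E : (recipients sg `&` [set th | s2 sg th]) `&` `[0, 1] = gov `&` `[0, 1].
  apply/seteqP; split => x /=; rewrite !in_itv/=; last first.
    by case=> [[xt aE] x01]; split => //; split => //; have [|_] := @early x; first slra.
  move=> [[aE sE] x01]; split => //; split => //=; rewrite leNgt; apply/negP => xt.
  move: aE sE; rewrite /recipients/=.
  have [xg|gx] := leP x thg; first by have [|_ /negbTE->] := @middle x; first slra.
  have [x2|x2] := leP x th2; first by have [|->] := @delayed x; first slra.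
  by have [|->] := @never x; first slra.
by rewrite -(eq_cexp f E) h// (eq_mass f E).
Qed.

(** No positive-mass premise is needed here, since [thg < th2] gives the late sellers positive
    mass. *)
Lemma pool_p2n : p2n sg = cexp f (mkt `|` late).
Proof.
case: heq => _ [_ [_ [_ [_ [_ [_ [_ [_ [h _]]]]]]]]].
have E : (nonrecipients sg `&` [set th | s2 sg th]) `&` `[0, 1] =
    (mkt `|` late) `&` `[0, 1].
  apply/seteqP; split => x /=; rewrite !in_itv/=; last first.
    case=> [[[xt aE]|xl] x01]; split => //; rewrite /nonrecipients/=.
      by rewrite aE; split => //; have [|_] := @early x; first slra.
    by have [-> ->] := delayed xl.
  move=> [[aE sE] x01]; split => //; move: aE sE; rewrite /nonrecipients/=.
  have [xt|tx] := leP x th1.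
    by have [|[->|-> _ _]] := @early x; [slra| |left].
  have [xg|gx] := leP x thg; first by have [|_ /negbTE->] := @middle x; first slra.
  have [x2|x2] := leP x th2; first by right.
  by have [|_ /negbTE->] := @never x; first slra.
rewrite -(eq_cexp f E) h// (eq_mass f E).
apply: (@mass_gt0 _ _ hf _ thg th2) => //; [exact: measurableU | slra |].
by move=> x /andP[gx x2]; right; rewrite /= gx ltW.
Qed.

(** When [th2 < 1] there are types above [th2]; they refuse the price that [th2] accepts. *)
Lemma sell_p2n_th2 : th2 < 1 -> p2n sg + S = th2.
Proof.
move=> h; rewrite -sell_p2n; apply/eqP; rewrite eq_le th2_le_sell andbT.
apply: le_of_right h _ => y hy; have [aE sE] := never hy.
have y01 : 0 <= y <= 1 by slra.
by have := s2N_ge y01 sE; rewrite aE.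
Qed.

(** Any early market seller earns the common early payoff, so [sell (p1 sg) = th1]. The pool mean
    [p1] lies below [th1], so a sale yields more than its price and the project must be funded. *)
Lemma mkt_price : 0 < mass f mkt -> I <= p1 sg /\ p1 sg + S = th1.
Proof.
move=> M0; have lt1 : p1 sg < th1.
  by rewrite pool_p1//; apply: cexp_lt => // x [].
have P1 : sell (p1 sg) = th1.
  suff [x [x0 xM]] : exists x, 0 <= x /\ mkt x.
    case: xM => /= x1 aE; have h : 0 <= x <= th1 by slra.
    by have := eqpay_early h; rewrite (eqpay_mkt h aE); slra.
  apply: contrapT => N; move: M0; rewrite (@eq_mass _ _ _ set0).
    by rewrite /mass set0I integral_set0 ltxx.
  apply/seteqP; split => x /=; rewrite in_itv/=; last by case.
  by move=> [xM /andP[x0 _]]; exfalso; apply: N; exists x.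
have p1I : I <= p1 sg by apply: (@sellpay_gt _ _ S); rewrite P1.
by split => //; rewrite -P1 sellpay_funded.
Qed.

Lemma gov_price : 0 < mass f gov -> I <= p2g sg /\ pg + S + p2g sg = th1 + p2n sg.
Proof.
move=> G0; have lt1 : p2g sg < th1.
  by rewrite pool_p2g//; apply: cexp_lt => // x [].
have P2 : pg + S + sell (p2g sg) = th1 + sell (p2n sg).
  suff [x [x0 xG]] : exists x, 0 <= x /\ gov x.
    case: xG => /= x1 aE; have h : 0 <= x <= th1 by slra.
    by have := eqpay_early h; rewrite (eqpay_gov h aE).
  apply: contrapT => N; move: G0; rewrite (@eq_mass _ _ _ set0).
    by rewrite /mass set0I integral_set0 ltxx.
  apply/seteqP; split => x /=; rewrite in_itv/=; last by case.
  by move=> [xG /andP[x0 _]]; exfalso; apply: N; exists x.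
have p2I : I <= p2g sg.
  by apply: (@sellpay_gt _ _ S); have := sell_pg_le; slra.
by split => //; move: P2; rewrite sell_p2n sellpay_funded//; slra.
Qed.

Let uniq_th0 t : 0 < t < 1 -> cexp f (below t) = t - S -> t = th0.
Proof. by move=> t01 tE; apply: hth0uniq. Qed.

(* If no early type took the bailout, a buyer could overbid for the recipients
   in [(th1, thg]]; if that interval is empty, the pool of sellers at [t = 2] is
   [[0, th2]], which forces [th2 = th0]. *)
Lemma mass_gov_gt0 : 0 < mass f gov.
Proof.
rewrite lt0r mass_ge0// andbT; apply/eqP => G0.
have M0 : 0 < mass f mkt by have := mass_le_gt0 hf th1_gt0; rewrite mass_below G0 add0r.
have [p1I p1E] := mkt_price M0.
have EM : cexp f (below th1) = cexp f mkt by rewrite (eq_cexp f belowE) cexpUl.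
have th1E : th1 = th0.
  by apply: uniq_th0; [slra | rewrite EM -pool_p1//; slra].
have [h|h] := ltP th1 thg.
  have [nE gE mE] := gov_only_prices h.
  have p2g_lt : p2g sg < th1.
    by rewrite ltNge; apply/negP => le2; move: gE; rewrite sellpay_funded; slra.
  (* A funded overbid that stays below [th1] while [p' + S] exceeds [th1], so it attracts recipients
     worth more than it costs. *)
  have [p' [p'I p'g p'1 p'S]] : exists p', [/\ I <= p', p2g sg < p', p' < th1 & th1 < p' + S].
    pose m := Num.max (Num.max (p2g sg) I) (th1 - S).
    have m1 : m < th1 by rewrite !gt_max; slra.
    have [] : [/\ p2g sg <= m, I <= m & th1 - S <= m].
      by rewrite !le_max !lexx !orbT.
    by exists ((m + th1) / 2); split; slra.
  (* The recipients above [th1] that accept [p'] are exactly those up to [m], the minimum of [thg]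
     and [p' + S]. *)
  have [m [th1m mg mS mP]] : exists m,
      [/\ th1 < m, m <= thg, m <= p' + S & forall x, x <= thg -> x <= p' + S -> x <= m].
    exists (Num.min thg (p' + S)); split; rewrite ?lt_min ?ge_min ?lexx ?orbT ?h//.
    by move=> x xg xp; rewrite le_min xg.
  pose E := [set x : R | th1 < x <= m].
  have mE' : measurable E by rewrite /E -set_itvoc; exact: measurable_itv.
  have E0 : 0 < mass f E.
    apply: (@mass_gt0 _ _ hf _ th1 m) => //; [slra | slra |].
    by move=> x /andP[a b]; rewrite /E /= a ltW.
  case: heq => _ [_ [_ [_ [_ [_ [_ [_ [[_ bert] _]]]]]]]].
  have AE : (recipients sg `&` [set th | th <= sell p']) `&` `[0, 1] =
      (gov `|` E) `&` `[0, 1].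
    rewrite sellpay_funded//; apply/seteqP; split => x /=; rewrite /E !in_itv/=.
      move=> [[aE xp] x01]; split => //.
      have [xt|tx] := leP x th1; [by left | right].
      rewrite /=; move: aE; rewrite /recipients/=.
      have [xg _|gx] := leP x thg; first exact: mP.
      have [x2|x2] := leP x th2; first by have [|->] := @delayed x; first slra.
      by have [|->] := @never x; first slra.
    case=> [[[xt aE]|/andP[tx xm]] x01]; split => //; split => //=; try by slra.
    by have [|] := @middle x; first slra.
  have GE0 : gov `&` E = set0.
    by apply/seteqP; split => // x [[/= xt _]]; rewrite /E /= ltNge xt.
  have := bert _ p'g; rewrite (eq_mass f AE) (eq_cexp f AE) massU// G0 add0r cexpUl//.
  move=> /(_ E0); apply/negP; rewrite -ltNge; apply: lt_trans p'1 _.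
  by apply: cexp_gt => // x; rewrite /E /= => /andP[/ltW].
have thgE : thg = th1 by apply/eqP; rewrite eq_le h th1_le.
have BE : below th2 `&` `[0, 1] = (gov `|` (mkt `|` late)) `&` `[0, 1].
  rewrite setUA [in RHS]setIUl -belowE -setIUl; congr (_ `&` _).
  by apply/seteqP; split => x /=; rewrite thgE; [case: leP => ?; [left|right] | case]; slra.
have n0 : gov `&` (mkt `|` late) = set0.
  rewrite setIUr gov_mkt0 set0U.
  by apply/seteqP; split => // x [[/= xt _]]; rewrite /= thgE; slra.
have p2nE : p2n sg = cexp f (below th2).
  by rewrite (eq_cexp f BE) cexpUl// -?pool_p2n//; exact: measurableU.
(* If [th2 < 1], then [th2] solves the equation of [th0], so [th2 = th1 = thg], against delay. If
   [th2 = 1], then [1 - cexp f (below 1) <= S], although this gap already equals [S] at [th0] and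
   strictly increases. *)
have [lt1|ge1] := ltP th2 1.
  have := sell_p2n_th2 lt1; have := @uniq_th0 th2; rewrite -p2nE; slra.
have th2E : th2 = 1 by apply/eqP; rewrite eq_le th2_le1.
have := th2_le_sell; rewrite sell_p2n p2nE th2E.
by have := @sub_cexp_le_incr _ _ hf hlc th0 1; slra.
Qed.

(* Otherwise [th1 = thg] and [E[theta | theta <= th1] > th1 - S], so that at [t = 1]
   a buyer offering slightly more than [th1 - S] would attract all types
   below some [t > th1] and make a profit. *)
Lemma p2n_eq : p2n sg = pg.
Proof.
apply/eqP; rewrite eq_le; apply/andP; split; last by have := sell_pg_le; rewrite sell_p2n; slra.
rewrite leNgt; apply/negP => pgn.
have thgE : thg = th1.
  apply/eqP; rewrite eq_le th1_le andbT leNgt; apply/negP => /gov_only_prices[].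
  by rewrite sell_p2n; slra.
have G0 := mass_gov_gt0; have [p2gI p2gE] := gov_price G0.
have bert t : th1 < t <= 1 -> I + S <= t -> p1 sg + S < t -> cexp f (below t) <= t - S.
  move=> t1 tI pt; case: heq => _ [_ [_ [_ [_ [_ [_ [[_ h] _]]]]]]].
  (* Every type above [th1] forgoes the first sale and keeps its continuation value, so it accepts
     [t - S] exactly when it is at most [t]; early types earn as much as [th1] would by waiting, and
     accept too. *)
  have AE : [set th | eqpay I S pg sg th <= sell (t - S) + cont2 I S sg Mkt th] `&` `[0, 1] =
      below t `&` `[0, 1].
    rewrite sellpay_funded; last by slra.
    rewrite subrK; apply/seteqP; split => x /= [+ x01]; rewrite in_itv/= in x01 *;
      move=> xt; split=> //; move: xt; rewrite /cont2/=.
      have [xt|tx] := leP x th1; first by slra.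
      have [x2|x2] := leP x th2.
        rewrite eqpay_late; last by slra.
        by rewrite max_l ?lerD2r// (le_trans x2)// th2_le_sell.
      have [|aE sE] := @never x; first by slra.
      have := s2N_ge x01 sE; rewrite aE /= => /max_r ->.
      by rewrite /eqpay aE (negbTE sE)/= lerD2r.
    have [xt|tx] := leP x th1.
      rewrite eqpay_early; last by slra.
      move=> _; rewrite max_l; last by have := th2_le_sell; slra.
      by rewrite lerD2r; slra.
    have [x2|x2] := leP x th2.
      rewrite eqpay_late; last by slra.
      by rewrite max_l ?lerD2r// (le_trans x2)// th2_le_sell.
    have [|aE sE] := @never x; first by slra.
    have := s2N_ge x01 sE; rewrite aE /= => /max_r ->.
    by rewrite /eqpay aE (negbTE sE)/= lerD2r.
  have := h (t - S); rewrite (eq_mass f AE) (eq_cexp f AE); apply; first by slra.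
  by apply: mass_le_gt0 => //; slra.
(* Indifference gives [p2g = th1 - S + (p2n - pg)], which exceeds [th1 - S]; early market sellers,
   if any, have mean exactly [th1 - S]. *)
have gt1 : th1 - S < cexp f (below th1).
  rewrite (eq_cexp f belowE); apply: cexp_gtU => //.
    by rewrite -pool_p2g//; slra.
  by move=> M0; rewrite -pool_p1//; have [_] := mkt_price M0; slra.
(* The base point is [th1], raised to [I + S] if an offer of [th1 - S] would not fund the project.
   In the latter case almost all early types are recipients, with mean [p2g >= I]. *)
have [t0 [t01 t0I t01' gt0 pt0]] : exists t0, [/\ th1 <= t0, I + S <= t0, t0 < 1,
    t0 - S < cexp f (below t0) & p1 sg + S <= t0].
  have p1E : p1 sg < I \/ p1 sg + S <= th1.
    by have := sell_p1_le; rewrite /sellpay; case: (leP I); [right | left].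
  have [h|h] := leP (I + S) th1.
    by exists th1; split => //; [slra | case: p1E; slra].
  exists (I + S); split; [slra | slra | slra | | case: p1E; slra].
  have : cexp f (below th1) < cexp f (below (I + S)) by apply: cexp_le_incr => //; slra.
  suff : I <= cexp f (below th1) by slra.
  have [M0|M0] := ltP 0 (mass f mkt); first by have := mkt_price M0; slra.
  rewrite (eq_cexp f belowE) setUC cexpUl// -?pool_p2g//; first by rewrite setIC.
  by apply/eqP; rewrite eq_le M0 mass_ge0.
(* With this [t > t0], the offer [t - S] is at most the mean below [t0], hence strictly less than
   the mean below [t]: a profitable overbid. *)
pose t := Num.min 1 (cexp f (below t0) + S).
have t0t : t0 < t by rewrite lt_min t01'; slra.
have [t1 tE] : t <= 1 /\ t <= cexp f (below t0) + S by rewrite !ge_min !lexx orbT.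
have := @bert t; have : cexp f (below t0) < cexp f (below t) by apply: cexp_le_incr => //; slra.
by slra.
Qed.

Lemma gov_price_eq : p2g sg + S = th1.
Proof. by have [_] := gov_price mass_gov_gt0; rewrite p2n_eq; slra. Qed.

(** Both groups of early sellers have mean [th1 - S], so [th1] solves the equation of [th0]. *)
Lemma th1_eq : th1 = th0.
Proof.
apply: uniq_th0; first by slra.
rewrite (eq_cexp f belowE); apply: cexpU => //.
- exact: mass_gov_gt0.
- by rewrite -pool_p2g ?mass_gov_gt0// -gov_price_eq addrK.
- by move=> M0; rewrite -pool_p1//; have [_ <-] := mkt_price M0; rewrite addrK.
Qed.

(** The corner [th2 = 1] would require [1 <= pg + S], against the bound on [pg]. *)
Lemma th2_eq : th2 = pg + S.
Proof.
rewrite -p2n_eq sell_p2n_th2// lt_neqAle th2_le1 andbT; apply/eqP => th2E.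
by have := th2_le_sell; rewrite sell_p2n p2n_eq; slra.
Qed.

End delayed.

Theorem theorem4 (R : realType) (f : R -> R) (I S pg th0 : R)
  (hf : is_density f) (hlc : strictly_logconcave f) (hmon : monotone_condition f)
  (hI : 0 < I) (hS : 0 < S)
  (hth0 : 0 < th0 < 1)
  (hth0fix : th0 - S = cexp f [set x | x <= th0])
  (hth0uniq : forall t, 0 < t < 1 -> t - S = cexp f [set x | x <= t] -> t = th0)
  (hp0I : I <= cexp f [set x | x <= th0])
  (hpg : cexp f [set x | x <= th0] < pg < 1 - S)
  (sg : profile R) (th1 thg th2 : R)
  (heq : equilibrium f I S pg sg)
  (hcut : has_cutoffs sg th1 thg th2)
  (hdelayed : thg < th2) :
  th1 = th0 /\ th0 <= thg /\ thg < pg + S /\ th2 = pg + S /\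
  (* (i) *)
  (forall th, 0 <= th <= th0 -> a1 sg th <> NoSale /\ s2 sg th) /\
  0 < mass f ([set x | x <= th0] `&` [set x | a1 sg x = Gov]) /\
  (* (ii) *)
  (0 < mass f ([set x | x <= th0] `&` [set x | a1 sg x = Mkt]) ->
     p1 sg = cexp f [set x | x <= th0] /\ p2n sg = pg /\
     cexp f ([set x | x <= th0] `&` [set x | a1 sg x = Mkt])
       = cexp f [set x | x <= th0]) /\
  p2g sg = cexp f [set x | x <= th0] /\
  cexp f ([set x | x <= th0] `&` [set x | a1 sg x = Gov])
    = cexp f [set x | x <= th0] /\
  (* (iii) *)
  (forall th, th0 < th <= thg -> a1 sg th = Gov /\ ~~ s2 sg th) /\
  (* (iv) *)
  (forall th, thg < th <= pg + S -> a1 sg th = NoSale /\ s2 sg th) /\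
  p2n sg = pg /\
  (forall th, pg + S < th <= 1 -> a1 sg th = NoSale /\ ~~ s2 sg th).
Proof.
have D1 := th1_eq hf hlc hI hS hth0 hth0fix hth0uniq hp0I hpg heq hcut hdelayed.
have D2 := th2_eq hf hlc hI hS hth0 hth0fix hth0uniq hp0I hpg heq hcut hdelayed.
have pn := p2n_eq hf hlc hI hS hth0 hth0fix hth0uniq hp0I hpg heq hcut hdelayed.
have pgE := gov_price_eq hf hlc hI hS hth0 hth0fix hth0uniq hp0I hpg heq hcut hdelayed.
have G0 := mass_gov_gt0 hf hlc hI hS hth0 hth0fix hth0uniq hp0I hpg heq hcut hdelayed.
have gE := pool_p2g hI hS hth0 hth0fix hp0I hpg heq hcut hdelayed.
have mE := pool_p1 hI hS hth0 hth0fix hp0I hpg heq hcut hdelayed.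
have mp := mkt_price hf hI hS hth0 hth0fix hp0I hpg heq hcut hdelayed.
rewrite -hth0fix.
case: (hcut) => _ [h1g [_ [h21 hact]]].
subst th1 th2.
have p2g0 : p2g sg = th0 - S by rewrite -pgE addrK.
do 4 (split; first by [|lra]).
split; first by move=> th th01; case: (hact th) => [|+ _]; [lra | apply; lra].
split; first by [].
split.
  move=> M0; have [_ p1E] := mp M0; have p10 : p1 sg = th0 - S by rewrite -p1E addrK.
  by rewrite -mE.
split; first by [].
split; first by rewrite -gE.
split; first by move=> th th01; case: (hact th) => [|_ [+ _]]; [lra | exact].
split; first by move=> th th01; case: (hact th) => [|_ [_ [+ _]]]; [lra | exact].
split; first by [].
by move=> th th01; case: (hact th) => [|_ [_ [_ +]]]; [lra | apply; lra].
Qed.
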